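(* Let $G$ be a connected $(c,d)$-biregular simple graph with $c,d\ge2$ and $(c,d)\ne(2,2)$, which is not $K_{2,3}$, $K_{2,4}$, $K_{2,5}$, or $K_{3,3}$. Then \[ 1-\frac{c+d}{cd}\le\frac{\mathscr{K}_{nb}(G)}{\mathscr{K}_e(G)}<1. \]
   Context: A $(c,d)$-biregular graph is a bipartite graph in which every vertex in one part of the bipartition has degree $c$ and every vertex in the other part has degree $d$. Kemeny's constant of an irreducible finite Markov chain with transition matrix $P$ whose eigenvalues (with multiplicity) are $1=\rho_1,\rho_2,\dots,\rho_N$ (with $1$ simple) is $\mathscr{K}(P)=\sum_{i=2}^{N}\frac{1}{1-\rho_i}$. Arcs of $G$: for each edge $\{u,v\}$ the two ordered pairs $(u,v),(v,u)$. $\mathscr{K}_e(G)$ is Kemeny's constant of the chain on arcs where from $(u,v)$ one moves to $(v,w)$ with probability $1/\deg(v)$ for each neighbor $w$ of $v$. $\mathscr{K}_{nb}(G)$ is Kemeny's constant of the non-backtracking chain on arcs where from $(u,v)$ one moves to $(v,w)$ with probability $1/(\deg(v)-1)$ for each neighbor $w\neq u$ of $v$. *)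

(* Defs.v *)
From HB Require Import structures.
From mathcomp Require Import all_boot all_order all_algebra all_field.
Set Implicit Arguments. Unset Strict Implicit. Unset Printing Implicit Defensive.
Import Order.TTheory GRing.Theory Num.Theory.
Local Open Scope ring_scope.

Definition simple_graph (T : finType) (e : rel T) : Prop :=
  symmetric e /\ irreflexive e.

Definition connected_graph (T : finType) (e : rel T) : Prop :=
  forall x y : T, connect e x y.

Definition deg (T : finType) (e : rel T) (x : T) : nat := #|[set y | e x y]|.

Definition biregular (T : finType) (e : rel T) (c d : nat) : Prop :=
  exists A : {set T},
    [/\ forall x y, e x y -> (x \in A) != (y \in A),
        forall x, x \in A -> deg e x = c
      & forall x, x \notin A -> deg e x = d].

Definition is_complete_bipartite (T : finType) (e : rel T) (m n : nat) : Prop :=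
  exists A : {set T},
    [/\ #|A| = m, #|~: A| = n & forall x y, e x y = ((x \in A) != (y \in A))].

Definition arc (T : finType) (e : rel T) := {a : T * T | e a.1 a.2}.

Definition arc_of (T : finType) (e : rel T) (i : 'I_#|{: arc e}|) : arc e :=
  enum_val i.

Definition P_edge (T : finType) (e : rel T) : 'M[algC]_#|{: arc e}| :=
  \matrix_(i, j)
    let a := val (arc_of i) in let b := val (arc_of j) in
    if a.2 == b.1 then ((deg e a.2)%:R)^-1 else 0.

Definition P_nb (T : finType) (e : rel T) : 'M[algC]_#|{: arc e}| :=
  \matrix_(i, j)
    let a := val (arc_of i) in let b := val (arc_of j) in
    if (a.2 == b.1) && (b.2 != a.1) then ((deg e a.2)%:R - 1)^-1 else 0.

Definition eigenvalues (n : nat) (P : 'M[algC]_n) : seq algC :=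
  sval (closed_field_poly_normal (char_poly P)).

Definition kemeny (n : nat) (P : 'M[algC]_n) : algC :=
  \sum_(r <- rem 1 (eigenvalues P)) (1 - r)^-1.

Definition K_e (T : finType) (e : rel T) : algC := kemeny (P_edge e).
Definition K_nb (T : finType) (e : rel T) : algC := kemeny (P_nb e).

(* Main.v *)
Require Import Defs.
From HB Require Import structures.
From mathcomp Require Import all_boot all_order all_algebra all_field.
From mathcomp Require Import ring zify.
Import Order.TTheory GRing.Theory Num.Theory.
Local Open Scope ring_scope.

Set Implicit Arguments. Unset Strict Implicit. Unset Printing Implicit Defensive.

(**
Let m = #|A| and n = #|~: A|, let M = m c = n d be the number of edges, and let
N be the m x n biadjacency matrix.  Writing the arc chains in terms of head, tail
and reversal matrices, Sylvester's determinant identity (an Ihara-Bass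
computation) expresses both characteristic polynomials through the eigenvalues
l_i of N^T N:
  X^(m+2n) chi_e = X^(2M+m) prod_i (X^2 - l_i/(cd)),
  z^(m+n+M) a^n chi_nb = z^(2M) a^m prod_i (a b - l_i X^2 / ((c-1)(d-1))),
with z = X^2 - 1/((c-1)(d-1)), a = X^2 + 1/(d-1), b = X^2 + 1/(c-1).
Connectivity makes l = cd a simple eigenvalue, and the others lie in [0, cd[.
Kemeny's constant is the logarithmic derivative at 1 of the characteristic
polynomial divided by X - 1.  With S = sum 1/(1 - l_i/(cd)) over the other
eigenvalues, alpha = 1 - (c+d)/(cd) and w = cd - c - d, this gives
  K_nb - alpha K_e = 2/w + (1 - alpha)/2 + 2m + 2n/d + 2 n alpha >= 0,
  K_e - K_nb = 2/(cdw) ((c+d) w S - n c w - cd).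
Since S >= n - 1, the latter is positive as soon as w (nd - c - d) > cd, which is
an inequality between integers that holds for all but the excluded graphs.
The unqualified name [arc] denotes the sub-arc function of path.v, whence [Defs.arc].
*)

(** * Polynomial identities and determinants of block matrices *)

(** In characteristic zero the naturals below the size of [p - q] are distinct roots of it, more
    than its degree allows. *)
Lemma poly_ext_horner (R : numDomainType) (p q : {poly R}) :
  (forall x, p.[x] = q.[x]) -> p = q.
Proof.
move=> pq; apply/eqP; rewrite -subr_eq0; apply/eqP.
pose rs := [seq i%:R : R | i <- iota 0 (size (p - q))].
apply: (@roots_geq_poly_eq0 _ _ rs).
- by apply/allP => x _; rewrite /root hornerD hornerN pq subrr.
- by rewrite map_inj_uniq ?iota_uniq // => i j /eqP; rewrite eqr_nat => /eqP.
- by rewrite size_map size_iota.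
Qed.

Lemma horner_char_poly (R : comNzRingType) n (P : 'M[R]_n) x :
  (char_poly P).[x] = \det (x%:M - P).
Proof.
rewrite /char_poly -horner_evalE -det_map_mx; congr (\det _).
apply/matrixP=> i j; rewrite !mxE /= /horner_eval hornerD hornerN hornerC.
by rewrite hornerMn hornerX.
Qed.

Section BlockDeterminants.

Variable R : comNzRingType.

(** A Schur complement without division: right multiplication by the block matrix with rows (1, -X)
    and (0, a) clears the upper right block. The powers of [a] keep it valid when [a] is not
    invertible. *)
Lemma det_scalar_diag_block m n (a b : R) (X : 'M_(m, n)) (Y : 'M_(n, m)) :
  a ^+ n * \det (block_mx a%:M X Y b%:M) =
  a ^+ m * \det ((a * b)%:M - Y *m X).
Proof.
have := congr1 determinant
  (mulmx_block (a%:M : 'M_m) X Y (b%:M : 'M_n) 1%:M (- X) 0 a%:M).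
rewrite det_mulmx det_ublock det1 mul1r det_scalar mulrC => ->.
rewrite !mulmx1 !mulmx0 !addr0 mulmxN mul_scalar_mx mul_mx_scalar addNr.
by rewrite det_lblock det_scalar mulmxN -scalar_mxM [b * a]mulrC addrC.
Qed.

(** Sylvester's identity: the block matrix with rows (a, U) and (V, 1) has two Schur complements,
    one for each diagonal block. *)
Lemma det_scalar_sub_mulC m n (a : R) (U : 'M_(m, n)) (V : 'M_(n, m)) :
  a ^+ n * \det (a%:M - U *m V) = a ^+ m * \det (a%:M - V *m U).
Proof.
have := det_scalar_diag_block a 1 U V; rewrite mulr1 => <-; congr (_ * _).
have := congr1 determinant
  (mulmx_block (a%:M : 'M_m) U V (1%:M : 'M_n) 1%:M 0 (- V) 1%:M).
rewrite det_mulmx det_lblock !det1 !mulr1 => ->.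
by rewrite !mulmx1 !mulmx0 !mul1mx !add0r addrN mulmxN det_ublock det1 mulr1.
Qed.

End BlockDeterminants.

(** * Kemeny's constant as a logarithmic derivative at 1 *)

Section LogDerivative.

Variable R : fieldType.
Implicit Types p q : {poly R}.

Definition logderiv1 p : R := p^`().[1] / p.[1].

Lemma logderiv1M p q : p.[1] != 0 -> q.[1] != 0 ->
  logderiv1 (p * q) = logderiv1 p + logderiv1 q.
Proof.
move=> p0 q0; rewrite /logderiv1 derivM hornerD !hornerM.
by field; rewrite p0 q0.
Qed.

Lemma logderiv1_1 : logderiv1 1 = 0.
Proof. by rewrite /logderiv1 -polyC1 derivC horner0 mul0r. Qed.

Lemma logderiv1_prod (I : Type) (r : seq I) (P : pred I) (F : I -> {poly R}) :
  (forall i, P i -> (F i).[1] != 0) ->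
  logderiv1 (\prod_(i <- r | P i) F i) = \sum_(i <- r | P i) logderiv1 (F i).
Proof.
(* The induction carries nonvanishing at 1 along with the value, because the product rule needs it
   for the partial products. *)
move=> F0; pose K (p : {poly R}) s := p.[1] != 0 /\ logderiv1 p = s.
suff [] : K (\prod_(i <- r | P i) F i) (\sum_(i <- r | P i) logderiv1 (F i)).
  by [].
apply: (big_ind2 K) => [|p s q t [p0 <-] [q0 <-]|i Pi].
- by rewrite /K logderiv1_1 hornerC oner_eq0.
- by rewrite /K logderiv1M // hornerM mulf_neq0.
- by split; first exact: F0.
Qed.

Lemma logderiv1X p k : p.[1] != 0 -> logderiv1 (p ^+ k) = logderiv1 p *+ k.
Proof.
move=> p0; rewrite -[k in LHS]card_ord -prodr_const logderiv1_prod //.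
by rewrite sumr_const card_ord.
Qed.

Lemma logderiv1_XsubC r : logderiv1 ('X - r%:P) = (1 - r)^-1.
Proof. by rewrite /logderiv1 derivXsubC !hornerE. Qed.

End LogDerivative.

(** Here [q] is the product of the X - r over the other eigenvalues, and each factor contributes (1
    - r)^-1. The condition [q.[1] != 0] says that the eigenvalue 1 is simple. *)
Lemma kemenyE n (P : 'M[algC]_n) (q : {poly algC}) :
  char_poly P = ('X - 1%:P) * q -> q.[1] != 0 -> kemeny P = logderiv1 q.
Proof.
rewrite /kemeny /eigenvalues.
case: closed_field_poly_normal => rs /= ->.
rewrite (monicP (char_poly_monic P)) scale1r => def_q q0.
have rs1 : 1 \in rs.
  by rewrite -root_prod_XsubC def_q rootM root_XsubC eqxx.
move: def_q; rewrite (big_rem 1 rs1) /= => /(mulfI (negbT (polyXsubC_eq0 _))).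
move=> def_q; move: q0; rewrite -def_q => q0.
rewrite big_seq [in RHS]big_seq logderiv1_prod => [|r rs_r].
  by apply: eq_bigr => r _; rewrite logderiv1_XsubC.
rewrite !hornerE subr_eq0; apply: contraNneq q0 => r1.
by move: rs_r; rewrite -r1 -root_prod_XsubC.
Qed.

(** * Arc matrices and the two characteristic polynomials *)

Section IncidenceMatrices.

Variables (T : finType) (e : rel T) (A : {set T}).

Local Notation m := #|A|.
Local Notation n := #|~: A|.
Local Notation p := #|{: Defs.arc e}|.
Local Notation arc_at i := (val (arc_of i)).

(** Numbers the vertices of [A] first, so that vertex matrices split into blocks along the
    bipartition. *)
Definition vtx (i : 'I_(m + n)) : T :=
  match split i with inl j => enum_val j | inr j => enum_val j end.

Lemma vtx_lshift (i : 'I_m) : vtx (lshift n i) = enum_val i.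
Proof. by rewrite /vtx (unsplitK (inl i)). Qed.

Lemma vtx_rshift (j : 'I_n) : vtx (rshift m j) = enum_val j.
Proof. by rewrite /vtx (unsplitK (inr j)). Qed.

Lemma vtx_inj : injective vtx.
Proof.
move=> i j; case: (split_ordP i) => i' ->; case: (split_ordP j) => j' ->;
  rewrite ?vtx_lshift ?vtx_rshift => eq_ij.
- by rewrite (enum_val_inj eq_ij).
- by have := enum_valP j'; rewrite inE -eq_ij enum_valP.
- by have := enum_valP i'; rewrite inE eq_ij enum_valP.
- by rewrite (enum_val_inj eq_ij).
Qed.

Lemma sum_vtx (V : zmodType) (F : T -> V) : \sum_i F (vtx i) = \sum_v F v.
Proof.
rewrite big_split_ord /= (bigID (mem A)) /=.
under eq_bigr do rewrite vtx_lshift.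
under [X in _ + X = _]eq_bigr do rewrite vtx_rshift.
rewrite -!big_enum_val /=; congr (_ + _).
by apply: eq_bigl => v; rewrite inE.
Qed.

Lemma sum_arc (V : zmodType) (F : T * T -> V) :
  \sum_(i < p) F (arc_at i) = \sum_u \sum_(v | e u v) F (u, v).
Proof.
rewrite /arc_of -(big_enum_val (fun a : Defs.arc e => F (val a))) /=.
rewrite (pair_big_dep xpredT e (fun u v => F (u, v))) /=.
rewrite -(big_sub [pred a : T * T | e a.1 a.2]) /=.
by apply: eq_bigr => -[u v].
Qed.

Lemma arc_at_inj : injective (fun i : 'I_p => arc_at i).
Proof. by move=> i j /val_inj/enum_val_inj. Qed.

Definition tail_mx : 'M[algC]_(m + n, p) :=
  \matrix_(i, j) ((arc_at j).1 == vtx i)%:R.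

Definition head_mx (w : T -> algC) : 'M[algC]_(p, m + n) :=
  \matrix_(i, j) (((arc_at i).2 == vtx j)%:R * w (vtx j)).

(** Arc reversal weighted at the head: exactly the backtracking moves to be subtracted from
    [head_mx w *m tail_mx]. *)
Definition rev_mx (w : T -> algC) : 'M[algC]_p :=
  \matrix_(i, j) ((arc_at j == ((arc_at i).2, (arc_at i).1))%:R * w (arc_at i).2).

Lemma head_tailE w i j :
  (head_mx w *m tail_mx) i j = ((arc_at i).2 == (arc_at j).1)%:R * w (arc_at i).2.
Proof.
rewrite mxE; under eq_bigr do rewrite !mxE.
rewrite (sum_vtx (fun v => ((arc_at i).2 == v)%:R * w v * ((arc_at j).1 == v)%:R)).
rewrite (bigD1 (arc_at i).2) //= eqxx big1 => [|v /negPf vi].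
  by rewrite addr0 mul1r mulrC eq_sym.
by rewrite eq_sym vi !mul0r.
Qed.

Lemma tail_headE w i j :
  (tail_mx *m head_mx w) i j = (e (vtx i) (vtx j))%:R * w (vtx j).
Proof.
rewrite mxE; under eq_bigr do rewrite !mxE.
rewrite (sum_arc (fun a => (a.1 == vtx i)%:R * ((a.2 == vtx j)%:R * w (vtx j)))).
rewrite (bigD1 (vtx i)) //= [X in _ + X]big1 => [|u /negPf ui]; last first.
  by apply: big1 => v _; rewrite ui mul0r.
rewrite addr0 big_mkcond (bigD1 (vtx j)) //= big1 => [|v /negPf vj].
  by rewrite !eqxx addr0 !mul1r; case: e; rewrite ?mul1r ?mul0r.
by rewrite vj mul0r mulr0 if_same.
Qed.

Lemma P_edgeE : P_edge e = head_mx (fun v => (deg e v)%:R^-1) *m tail_mx.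
Proof.
apply/matrixP=> i j; rewrite head_tailE mxE /=.
by case: eqP => _; rewrite ?mul1r ?mul0r.
Qed.

Definition nbw v : algC := ((deg e v)%:R - 1)^-1.

Lemma P_nbE : P_nb e = head_mx nbw *m tail_mx - rev_mx nbw.
Proof.
apply/matrixP=> i j; rewrite [RHS]mxE head_tailE !mxE /= /nbw.
rewrite [_ == (_, _)]xpair_eqE [(arc_at j).1 == _]eq_sym.
by do 2?case: eqP => _; rewrite ?mul1r ?mul0r ?subrr ?subr0.
Qed.

Hypothesis e_sym : symmetric e.

(** Each row of [rev_mx w] has one nonzero entry, at the reversed arc. Giving [M] through a function
    [f] on all pairs avoids naming the index of that arc. *)
Lemma rev_mulE w (q : nat) (M : 'M_(p, q)) (f : T * T -> 'I_q -> algC) i j :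
  (forall i j, M i j = f (arc_at i) j) ->
  (rev_mx w *m M) i j = w (arc_at i).2 * f ((arc_at i).2, (arc_at i).1) j.
Proof.
move=> Mf; rewrite mxE; under eq_bigr do rewrite mxE Mf.
set a := arc_at i.
have e_a : e a.2 a.1 by rewrite e_sym /a; case: (arc_of i).
rewrite (sum_arc (fun b => (b == (a.2, a.1))%:R * w a.2 * f b j)).
rewrite (bigD1 a.2) //= [X in _ + X]big1 => [|u /negPf ui]; last first.
  by apply: big1 => v _; rewrite xpair_eqE ui !mul0r.
rewrite addr0 (bigD1 a.1) //= eqxx mul1r big1 ?addr0 // => v /andP[_ /negPf vj].
by rewrite xpair_eqE vj andbF !mul0r.
Qed.

(** Leaving a vertex along an arc and reversing it leads back to the same vertex, hence a diagonal
    matrix. *)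
Lemma tail_rev_headE w w' i j :
  (tail_mx *m (rev_mx w *m head_mx w')) i j =
  (i == j)%:R * (\sum_(v | e (vtx i) v) w v) * w' (vtx j).
Proof.
pose f (a : T * T) j := (a.2 == vtx j)%:R * w' (vtx j).
have head_f k l : head_mx w' k l = f (arc_at k) l by rewrite mxE.
rewrite mxE; under eq_bigr do rewrite mxE (rev_mulE w _ _ head_f).
rewrite (sum_arc (fun a => (a.1 == vtx i)%:R *
  (w a.2 * ((a.1 == vtx j)%:R * w' (vtx j))))).
rewrite (bigD1 (vtx i)) //= [X in _ + X]big1 => [|u /negPf ui]; last first.
  by apply: big1 => v _; rewrite ui mul0r.
rewrite addr0 eqxx (inj_eq vtx_inj) mulr_sumr mulr_suml.
by apply: eq_bigr => v _; rewrite mul1r mulrCA mulrA.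
Qed.

Lemma rev_mul_rev w (r : algC) : (forall u v, e u v -> w u * w v = r) ->
  rev_mx w *m rev_mx w = r%:M.
Proof.
move=> wr; apply/matrixP=> i j.
pose f (a : T * T) (j : 'I_p) := (arc_at j == (a.2, a.1))%:R * w a.2.
have rev_f k l : rev_mx w k l = f (arc_at k) l by rewrite mxE.
rewrite (rev_mulE w _ _ rev_f) /f.
rewrite /= -surjective_pairing mxE.
have e_i : e (arc_at i).1 (arc_at i).2 by case: (arc_of i).
rewrite (inj_eq arc_at_inj) mulrCA [w _ * w _]mulrC wr //.
by rewrite eq_sym mulrC mulr_natr.
Qed.

Hypothesis e_bip : forall x y, e x y -> (x \in A) != (y \in A).

(* Conjugating by the sign of the part of the tail negates the reversal matrix. *)
Lemma det_add_rev w x : \det (x%:M + rev_mx w) = \det (x%:M - rev_mx w).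
Proof.
pose s (v : T) : algC := if v \in A then 1 else -1.
pose S := diag_mx (\row_(i < p) s (arc_at i).1).
have sK v : s v * s v = 1 by rewrite /s; case: ifP => _; ring.
have SS : S *m S = 1%:M.
  rewrite mulmx_diag -diag_const_mx; congr diag_mx.
  by apply/rowP => i; rewrite !mxE sK.
have -> : x%:M + rev_mx w = S *m (x%:M - rev_mx w) *m S.
  rewrite mulmxBr mulmxBl mul_mx_scalar -scalemxAl SS scalemx1; congr (_ + _).
  apply/matrixP => i j; rewrite [RHS]mxE mul_mx_diag mxE mul_diag_mx !mxE.
  case: eqP => [->|_] /=; last by rewrite !(mulr0, mul0r) oppr0.
  have : e (arc_at i).1 (arc_at i).2 by case: (arc_of i).
  by move/e_bip; rewrite /s; case: (_ \in A); case: (_ \in A) => //= _; ring.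
by rewrite !det_mulmx mulrC mulrA -det_mulmx SS det1 mul1r.
Qed.

(** With R the reversal matrix, (x - R)(x + R) = x^2 - r and both factors have the same determinant,
    so the square of the characteristic polynomial is known. *)
Lemma char_poly_rev w (r : algC) M : (forall u v, e u v -> w u * w v = r) ->
  p = M.*2 -> char_poly (rev_mx w) = ('X^2 - r%:P) ^+ M.
Proof.
move=> wr pM; set g := char_poly _.
have mon : ('X^2 - r%:P) ^+ M \is monic.
  by rewrite monic_exp // (monicXnsubC _ (isT : 0 < 2)%N).
have : g ^+ 2 = (('X^2 - r%:P) ^+ M) ^+ 2.
  apply: poly_ext_horner => x; rewrite !horner_exp horner_char_poly.
  rewrite expr2 -{1}det_add_rev -det_mulmx mulmxBr !mulmxDl.
  rewrite (rev_mul_rev wr) !mul_scalar_mx mul_mx_scalar opprD addrA addrK.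
  rewrite scale_scalar_mx -raddfB det_scalar pM -muln2 exprM.
  by rewrite !hornerE.
(* Of the two square roots, monicity rules out the negative one. *)
move/eqP; rewrite eqf_sqr => /orP[/eqP //|/eqP g_opp].
have := monicP (char_poly_monic (rev_mx w)); rewrite -/g g_opp lead_coefN.
by rewrite (monicP mon) => /eqP; rewrite -subr_eq0 -opprD oppr_eq0 -mulr2n pnatr_eq0.
Qed.

Definition biadj : 'M[algC]_(m, n) :=
  \matrix_(i, j) (e (enum_val i) (enum_val j))%:R.

Definition cogram : 'M[algC]_n := biadj^T *m biadj.

Lemma tail_head_block (w : T -> algC) wA wB :
  (forall v, v \in A -> w v = wA) -> (forall v, v \notin A -> w v = wB) ->
  tail_mx *m head_mx w = block_mx 0 (wB *: biadj) (wA *: biadj^T) 0.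
Proof.
move=> hA hB; apply/matrixP=> i j; rewrite tail_headE.
have in_m (k : 'I_m) : enum_val k \in A by rewrite enum_valP.
have in_n (k : 'I_n) : enum_val k \notin A.
  by have := enum_valP k; rewrite inE.
have [i' ->|i' ->] := split_ordP i; have [j' ->|j' ->] := split_ordP j;
  rewrite ?block_mxEul ?block_mxEur ?block_mxEdl ?block_mxEdr !mxE
    ?vtx_lshift ?vtx_rshift.
- case: (boolP (e _ _)) => [/e_bip|_]; rewrite ?mul0r //.
  by rewrite !in_m.
- by rewrite hB // mulrC.
- by rewrite hA // e_sym mulrC.
- case: (boolP (e _ _)) => [/e_bip|_]; rewrite ?mul0r //.
  by rewrite !(negPf (in_n _)).
Qed.

(** Sylvester's identity passes from arcs to vertices, and the block determinant from vertices to
    the part [~: A]. The exponents [m + n] and [n] on the left record these two steps. *)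
Lemma char_poly_edge c d : (forall v, v \in A -> deg e v = c) ->
    (forall v, v \notin A -> deg e v = d) ->
  forall x, x ^+ (m + n + n) * (char_poly (P_edge e)).[x] =
    x ^+ (p + m) * \det ((x ^+ 2)%:M - (c%:R * d%:R)^-1 *: cogram).
Proof.
move=> dA dB x; rewrite horner_char_poly P_edgeE addnC exprD -mulrA.
rewrite det_scalar_sub_mulC exprD -[RHS]mulrA [LHS]mulrCA; congr (_ * _).
rewrite (@tail_head_block _ c%:R^-1 d%:R^-1) => [|v /dA->|v /dB->] //.
rewrite scalar_mx_block opp_block_mx add_block_mx !oppr0 !addr0 !add0r.
rewrite det_scalar_diag_block -expr2 mulNmx mulmxN opprK.
by rewrite -scalemxAl -scalemxAr scalerA invfM.
Qed.

Lemma char_poly_nb (c d : nat) M : (1 < c)%N -> (1 < d)%N ->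
    (forall v, v \in A -> deg e v = c) ->
    (forall v, v \notin A -> deg e v = d) -> p = M.*2 ->
  let wA := (c%:R - 1)^-1 in let wB := (d%:R - 1)^-1 in
  forall x, let z := x ^+ 2 - wA * wB in let a := x ^+ 2 + wB in
    let b := x ^+ 2 + wA in
    z ^+ (m + n + M) * a ^+ n * (char_poly (P_nb e)).[x] =
    z ^+ M.*2 * a ^+ m * \det ((a * b)%:M - (x ^+ 2 * wA * wB) *: cogram).
Proof.
move=> c1 d1 dA dB pM wA wB x z a b.
have nA v : v \in A -> nbw v = wA by rewrite /nbw => /dA ->.
have nB v : v \notin A -> nbw v = wB by rewrite /nbw => /dB ->.
have wr u v : e u v -> nbw u * nbw v = wA * wB.
  move/e_bip; case: (boolP (u \in A)) => uA; case: (boolP (v \in A)) => vA // _.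
    by rewrite nA // nB.
  by rewrite nB // nA // mulrC.
have det_rev : \det (x%:M - rev_mx nbw) = z ^+ M.
  by rewrite -horner_char_poly (char_poly_rev wr pM) horner_exp !hornerE.
rewrite horner_char_poly P_nbE opprB addrA exprD -det_rev.
set R := rev_mx nbw; set U := head_mx nbw; set V := tail_mx.
have RR : R *m R = (wA * wB)%:M by exact: rev_mul_rev.
(* Multiplying by x - R turns x + R into the scalar z, because R^2 is the scalar [wA * wB].
   Sylvester's identity then applies. *)
have -> : z ^+ (m + n) * \det (x%:M - R) * a ^+ n * \det (x%:M + R - U *m V) =
          a ^+ n * (z ^+ (m + n) * \det (z%:M - ((x%:M - R) *m U) *m V)).
  have -> : z%:M - ((x%:M - R) *m U) *m V = (x%:M - R) *m (x%:M + R - U *m V).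
    rewrite mulmxBr mulmxA; congr (_ - _).
    rewrite mulmxDr !mulmxBl RR !mul_scalar_mx mul_mx_scalar scale_scalar_mx -expr2.
    by rewrite addrA subrK /z raddfB.
  by rewrite det_mulmx; ring.
rewrite det_scalar_sub_mulC -pM mulrCA -[RHS]mulrA; congr (_ * _).
have nbr u v : e u v -> nbw v = if u \in A then wB else wA.
  move/e_bip; case: ifP => uA; case: (boolP (v \in A)) => vA // _; first exact: nB.
  exact: nA.
have sum_nbr u : \sum_(v | e u v) nbw v = (deg e u)%:R * if u \in A then wB else wA.
  rewrite (eq_bigr _ (nbr u)) sumr_const mulr_natl /deg; congr (_ *+ _).
  by apply: eq_card => v; rewrite !inE.
(* This and [zB] hold because (c - 1) [wA] = 1 and (d - 1) [wB] = 1. *)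
have zA : z + c%:R * wA * wB = a.
  by rewrite /z /a /wA; field; rewrite subr_eq0 pnatr_eq1 gtn_eqF.
have zB : z + d%:R * wA * wB = b.
  by rewrite /z /b /wB; field; rewrite subr_eq0 pnatr_eq1 gtn_eqF.
have VRU : V *m (R *m U) =
    block_mx (c%:R * wA * wB)%:M 0 0 (d%:R * wA * wB)%:M.
  apply/matrixP=> i j; rewrite tail_rev_headE sum_nbr.
  have in_m (k : 'I_m) : enum_val k \in A by rewrite enum_valP.
  have in_n (k : 'I_n) : enum_val k \notin A.
    by have := enum_valP k; rewrite inE.
  have [i' ->|i' ->] := split_ordP i; have [j' ->|j' ->] := split_ordP j;
    rewrite ?eq_lshift ?eq_rshift ?eq_lrshift ?eq_rlshift ?vtx_lshift ?vtx_rshift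
      ?block_mxEul ?block_mxEur ?block_mxEdl ?block_mxEdr !mxE ?mul0r //.
  - by rewrite in_m nA // dA // -mulrA mulr_natl mulrAC.
  - by rewrite (negPf (in_n _)) nB // dB // -mulrA mulr_natl.
have -> : z%:M - V *m ((x%:M - R) *m U) =
    block_mx a%:M (- (x * wB) *: biadj) (- (x * wA) *: biadj^T) b%:M.
  rewrite mulmxBl mul_scalar_mx mulmxBr -scalemxAr (tail_head_block nA nB) VRU.
  rewrite scalar_mx_block scale_block_mx !opp_block_mx !add_block_mx.
  rewrite !opp_block_mx !add_block_mx !scaler0 !subr0 !add0r !opprK -!raddfD /=.
  by rewrite zA zB !scalerA !scaleNr.
rewrite det_scalar_diag_block -scalemxAl -scalemxAr scalerA.
congr (_ * \det (_ - _ *: _)).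
by ring.
Qed.

End IncidenceMatrices.

(** A weighted Lagrange identity. With a row of the biadjacency matrix as weights and [u] the
    conjugate of [v], the left side is a Dirichlet energy. *)
Lemma sum_diff_mul_diff (R : comPzRingType) (I : finType) (a v u : I -> R) :
  \sum_j \sum_k a j * a k * ((v j - v k) * (u j - u k)) =
  ((\sum_j a j) * (\sum_j a j * (v j * u j)) -
   (\sum_j a j * v j) * (\sum_j a j * u j)) *+ 2.
Proof.
set s := \sum_j a j; set svu := \sum_j a j * (v j * u j).
set sv := \sum_j a j * v j; set su := \sum_j a j * u j.
transitivity (\sum_j (s * (a j * (v j * u j)) + svu * a j
                      - (su * (a j * v j) + sv * (a j * u j)))).
  apply: eq_bigr => j _; rewrite !mulr_suml -!big_split -sumrB /=.
  by apply: eq_bigr => k _; ring.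
by rewrite sumrB !big_split -!mulr_sumr /= -/s -/svu -/sv -/su; ring.
Qed.

(** * Spectrum of the Gram matrix of the biadjacency matrix *)

Section CogramSpectrum.

Variables (T : finType) (e : rel T) (A : {set T}) (c d : nat).

Local Notation m := #|A|.
Local Notation n := #|~: A|.

Hypothesis e_sym : symmetric e.
Hypothesis e_conn : connected_graph e.
Hypothesis e_bip : forall x y, e x y -> (x \in A) != (y \in A).
Hypothesis degA : forall x, x \in A -> deg e x = c.
Hypothesis degB : forall x, x \notin A -> deg e x = d.

Local Notation N := (biadj e A).
Local Notation W := (cogram e A).

Lemma degE x : ((deg e x)%:R : algC) = \sum_y (e x y)%:R.
Proof.
rewrite -sumr_const big_mkcond /deg; apply: eq_bigr => y _.
by rewrite !inE; case: e.
Qed.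

Lemma biadj_row_sum i : \sum_j N i j = c%:R.
Proof.
rewrite -(degA (enum_valP i)) degE (bigID (mem A)) /=
  [X in _ = X + _]big1 ?add0r => [|y yA].
  under eq_bigr do rewrite mxE.
  rewrite -(big_enum_val (fun y => (e (enum_val i) y)%:R)).
  by apply: eq_bigl => y; rewrite inE.
by case: (boolP (e _ _)) => // /e_bip; rewrite yA enum_valP.
Qed.

Lemma biadj_col_sum j : \sum_i N i j = d%:R.
Proof.
have jB : enum_val j \notin A by have := enum_valP j; rewrite inE.
rewrite -(degB jB) degE (bigID (mem A)) /= [X in _ = _ + X]big1 ?addr0 => [|y yA].
  under eq_bigr do rewrite mxE e_sym.
  by rewrite -(big_enum_val (fun y => (e (enum_val j) y)%:R)).
by case: (boolP (e _ _)) => // /e_bip; rewrite (negPf yA) (negPf jB).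
Qed.

Lemma card_parts : (m * c = n * d)%N.
Proof.
apply/eqP; rewrite -(eqr_nat algC) !natrM; apply/eqP.
transitivity (\sum_i \sum_j N i j).
  under eq_bigr do rewrite biadj_row_sum.
  by rewrite sumr_const card_ord mulr_natl.
rewrite exchange_big /=; under eq_bigr do rewrite biadj_col_sum.
by rewrite sumr_const card_ord mulr_natl.
Qed.

Lemma card_arcs : #|{: Defs.arc e}| = (m * c).*2.
Proof.
apply/eqP; rewrite -addnn {2}card_parts -(eqr_nat algC) natrD !natrM; apply/eqP.
have -> : #|{: Defs.arc e}|%:R = \sum_(i < #|{: Defs.arc e}|) 1 :> algC.
  by rewrite sumr_const card_ord.
rewrite (sum_arc e (fun=> 1 : algC)) (bigID (mem A)) /=.
have sum_deg u : \sum_(v | e u v) 1 = (deg e u)%:R :> algC.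
  by rewrite degE big_mkcond; apply: eq_bigr => v _; case: e.
rewrite (eq_bigr _ (fun u _ => sum_deg u)).
congr (_ + _).
  rewrite (eq_bigr (fun=> c%:R)) => [|u /degA -> //].
  by rewrite sumr_const mulr_natl.
rewrite (eq_bigr (fun=> d%:R)) => [|u /degB <- //].
rewrite sumr_const mulr_natl; congr (_ *+ _).
by apply: eq_card => u; rewrite !inE.
Qed.

(** Both sides compute v W v^*, the squared norm of N v^T; this makes the eigenvalues
    nonnegative. *)
Lemma eigenvector_sqr_norm (v : 'rV[algC]_n) l : v *m W = l *: v ->
  l * (\sum_j v 0 j * (v 0 j)^*) =
  \sum_i (\sum_j N i j * v 0 j) * (\sum_j N i j * (v 0 j)^*).
Proof.
move=> vW; under [RHS]eq_bigr do rewrite mulr_sumr.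
rewrite exchange_big /= mulr_sumr; apply: eq_bigr => k _.
have /rowP/(_ k) := vW; rewrite [RHS]mxE mulrA => <-.
rewrite /cogram mulmxA mxE mulr_suml; apply: eq_bigr => i _.
rewrite mulrA; congr (_ * _ * _); rewrite mxE; apply: eq_bigr => j _.
by rewrite [in RHS]mulrC !mxE.
Qed.

(** Its right side is a sum of nonnegative terms over pairs with a common neighbour in [A]. This
    gives both the bound cd on eigenvalues and the equality case. *)
Lemma eigenvector_energy (v : 'rV[algC]_n) l : v *m W = l *: v ->
  (c%:R * d%:R - l) * (\sum_j v 0 j * (v 0 j)^*) *+ 2 =
  \sum_i \sum_j \sum_k N i j * N i k * `|v 0 j - v 0 k| ^+ 2.
Proof.
move=> vW.
have row_energy i : \sum_j \sum_k N i j * N i k * `|v 0 j - v 0 k| ^+ 2 =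
    (c%:R * (\sum_j N i j * (v 0 j * (v 0 j)^*)) -
     (\sum_j N i j * v 0 j) * (\sum_j N i j * (v 0 j)^*)) *+ 2.
  rewrite -(biadj_row_sum i) -sum_diff_mul_diff.
  by apply: eq_bigr => j _; apply: eq_bigr => k _; rewrite normCK rmorphB.
rewrite (eq_bigr _ (fun i _ => row_energy i)).
rewrite sumrMnl sumrB; congr (_ *+ 2); rewrite mulrBl; congr (_ - _).
  rewrite -mulr_sumr exchange_big /= -mulrA; congr (_ * _).
  by rewrite mulr_sumr; apply: eq_bigr => j _; rewrite -mulr_suml biadj_col_sum.
exact: eigenvector_sqr_norm.
Qed.

Lemma biadj_ge0 i j : 0 <= N i j.
Proof. by rewrite mxE ler0n. Qed.

Lemma sqr_row_gt0 (v : 'rV[algC]_n) : v != 0 -> 0 < \sum_j v 0 j * (v 0 j)^*.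
Proof.
case/rV0Pn=> i vi; rewrite (bigD1 i) //= ltr_wpDr ?mul_conjC_gt0 //.
by apply: sumr_ge0 => j _; rewrite mul_conjC_ge0.
Qed.

Lemma cogram_eigen_ge0 (v : 'rV[algC]_n) l : v != 0 -> v *m W = l *: v -> 0 <= l.
Proof.
move=> v0 vW; rewrite -(pmulr_lge0 _ (sqr_row_gt0 v0)).
rewrite (eigenvector_sqr_norm vW); apply: sumr_ge0 => i _.
have -> : \sum_j N i j * (v 0 j)^* = (\sum_j N i j * v 0 j)^*.
  rewrite rmorph_sum; apply: eq_bigr => j _; rewrite rmorphM /=.
  by rewrite [(N i j)^*]conj_Creal // ger0_real ?biadj_ge0.
by rewrite mul_conjC_ge0.
Qed.

Lemma cogram_eigen_le (v : 'rV[algC]_n) l :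
  v != 0 -> v *m W = l *: v -> l <= c%:R * d%:R.
Proof.
move=> v0 vW; rewrite -subr_ge0 -(pmulr_lge0 _ (sqr_row_gt0 v0)).
rewrite -(pmulrn_lge0 _ (isT : 0 < 2)%N) eigenvector_energy //.
do 3!(apply: sumr_ge0 => ? _).
by rewrite !mulr_ge0 ?biadj_ge0 // exprn_ge0.
Qed.

(** At the eigenvalue cd the energy vanishes, so [v] agrees on vertices with a common neighbour;
    connectivity spreads this to all of [~: A]. *)
Lemma cogram_eigen_max (v : 'rV[algC]_n) : v *m W = (c%:R * d%:R) *: v ->
  forall j k, v 0 j = v 0 k.
Proof.
move=> /eigenvector_energy; rewrite subrr mul0r mul0rn => /esym E0.
have loc (i : 'I_m) (j k : 'I_n) :
    e (enum_val i) (enum_val j) -> e (enum_val i) (enum_val k) -> v 0 j = v 0 k.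
  move=> eij eik; apply/eqP; rewrite -subr_eq0 -normr_eq0 -sqrf_eq0; apply/eqP.
  have ge i' j' k' : 0 <= N i' j' * N i' k' * `|v 0 j' - v 0 k'| ^+ 2.
    by rewrite !mulr_ge0 ?biadj_ge0 // exprn_ge0.
  have ge1 i' j' : 0 <= \sum_k N i' j' * N i' k * `|v 0 j' - v 0 k| ^+ 2.
    by apply: sumr_ge0.
  have ge2 i' : 0 <= \sum_j \sum_k N i' j * N i' k * `|v 0 j - v 0 k| ^+ 2.
    by apply: sumr_ge0.
  have E1 : \sum_j \sum_k N i j * N i k * `|v 0 j - v 0 k| ^+ 2 = 0.
    exact: (psumr_eq0P (fun i _ => ge2 i) E0).
  have E2 : \sum_k N i j * N i k * `|v 0 j - v 0 k| ^+ 2 = 0.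
    exact: (psumr_eq0P (fun j _ => ge1 i j) E1).
  have : N i j * N i k * `|v 0 j - v 0 k| ^+ 2 = 0.
    exact: (psumr_eq0P (fun k _ => ge i j k) E2).
  have -> : N i j = 1 by rewrite mxE eij.
  have -> : N i k = 1 by rewrite mxE eik.
  by rewrite !mul1r.
move=> j0 k0.
(* An invariant that passes along every edge: a vertex of [~: A] has the value at [j0], and a vertex
   of [A] has only neighbours with that value. *)
pose Q x := if x \in A then forall k, e x (enum_val k) -> v 0 k = v 0 j0
            else forall k, x = enum_val k -> v 0 k = v 0 j0.
have Qstep x y : e x y -> Q x -> Q y.
  move=> exy; have := e_bip exy; rewrite /Q.
  case: ifPn => xA; case: ifPn => yA // _ Qx k.
    by move=> def_y; apply: Qx; rewrite -def_y.
  have xB : x \in ~: A by rewrite inE.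
  move=> eyk; rewrite -(Qx (enum_rank_in xB x)) ?enum_rankK_in //.
  by apply: (loc (enum_rank_in yA y)); rewrite !enum_rankK_in // e_sym.
have Qpath s x : path e x s -> Q x -> Q (last x s).
  elim: s x => //= y s IHs x /andP[exy ys] Qx; exact: IHs ys (Qstep _ _ exy Qx).
have jB (j : 'I_n) : (enum_val j \in A) = false.
  by apply: negbTE; have := enum_valP j; rewrite inE.
have Qj0 : Q (enum_val j0) by rewrite /Q jB => k /enum_val_inj ->.
have /connectP[s es def_k] := e_conn (enum_val j0) (enum_val k0).
have := Qpath _ _ es Qj0; rewrite -def_k /Q jB => /(_ k0 erefl) ->.
by [].
Qed.

(** [W] is Hermitian, hence unitarily diagonalisable. The two parameters [y] and [s] serve both
    characteristic polynomials at once. *)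
Lemma cogram_spectrum : (0 < n)%N ->
  exists (l : 'I_n -> algC) (i0 : 'I_n),
    [/\ l i0 = c%:R * d%:R, forall i, i != i0 -> 0 <= l i < c%:R * d%:R
      & forall y s, \det (y%:M - s *: W) = \prod_i (y - s * l i)].
Proof.
move=> n0.
have Wh : (map_mx Num.conj W^T) = W.
  apply/matrixP => i j; rewrite !mxE rmorph_sum; apply: eq_bigr => k _.
  by rewrite rmorphM !mxE !rmorph_nat mulrC.
have Wn : W \is normalmx by apply/normalmxP; rewrite Wh.
have /orthomx_spectralP := Wn; set P := spectralmx W; set D := spectral_diag W.
move=> WE.
have PU : P \is unitarymx := spectral_unitarymx W.
have Pu := unitarymx_unit PU.
have eigP i : row i P *m W = D 0 i *: row i P.
  rewrite WE !mulmxA -row_mul mulmxV // -!row_mul mul1mx; apply/rowP => j.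
  by rewrite mxE mul_diag_mx !mxE.
have P0 i : row i P != 0.
  apply: contraTneq (unitarymx_unit PU) => Pi; rewrite unitmxE.
  rewrite (expand_det_row _ i) big1 ?unitr0 // => j _.
  by have /rowP/(_ j) := Pi; rewrite !mxE => ->; rewrite mul0r.
have oneW : (const_mx 1 : 'rV_n) *m W = (c%:R * d%:R) *: const_mx 1.
  have -> : const_mx 1 *m W = \row_j \sum_i c%:R * N i j.
    apply/rowP => j; rewrite /cogram mulmxA [LHS]mxE [RHS]mxE.
    apply: eq_bigr => i _; congr (_ * _); rewrite -(biadj_row_sum i) mxE.
    by apply: eq_bigr => k _; rewrite !mxE mul1r.
  by apply/rowP => j; rewrite mxE -mulr_sumr biadj_col_sum !mxE mulr1.
(* Coordinates of the all-ones eigenvector in the eigenbasis: an index where [u] is nonzero must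
   carry the eigenvalue cd. *)
pose u : 'rV_n := const_mx 1 *m invmx P.
have uD : u *m diag_mx D = (c%:R * d%:R) *: u.
  have -> : u *m diag_mx D = const_mx 1 *m (invmx P *m diag_mx D *m P) *m invmx P.
    by rewrite !mulmxA mulmxK.
  by rewrite -WE oneW -scalemxAl.
have u0 : u != 0.
  apply: contraTneq n0 => u0; rewrite -leqNgt leqn0.
  have /rowP one0 : (const_mx 1 : 'rV[algC]_n) = 0.
    by rewrite -[const_mx 1](mulmxKV Pu) -/u u0 mul0mx.
  rewrite -(card_ord n); apply/eqP/eq_card0 => i.
  by have := one0 i; rewrite !mxE => /eqP; rewrite oner_eq0.
have /rV0Pn[i0 ui0] := u0.
have Di0 : D 0 i0 = c%:R * d%:R.
  have /rowP/(_ i0) := uD; rewrite mul_mx_diag [LHS]mxE [RHS]mxE mulrC.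
  exact: mulIf.
have Pcst i j : D 0 i = c%:R * d%:R -> P i j = P i i0.
  move=> Di; have := eigP i; rewrite Di => /cogram_eigen_max/(_ j i0).
  by rewrite !mxE.
have Pi_neq0 i : D 0 i = c%:R * d%:R -> P i i0 != 0.
  move=> Di; apply: contraNneq (P0 i) => Pi0; apply/eqP/rowP => j.
  by rewrite !mxE (Pcst i j Di).
exists (fun i => D 0 i), i0; split=> // [i ii0|y s].
  rewrite (cogram_eigen_ge0 (P0 i) (eigP i)) /= lt_neqAle.
  rewrite (cogram_eigen_le (P0 i) (eigP i)) andbT.
  (* A second index with eigenvalue cd would give two constant nonzero rows of [P], which cannot be
     orthogonal. *)
  apply: contraNneq ii0 => Di.
  have /unitarymxP/matrixP/(_ i i0) := PU; rewrite !mxE.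
  have -> : \sum_j P i j * (map_mx Num.conj P^T) j i0 = P i i0 * (P i0 i0)^* *+ n.
    transitivity (\sum_(j < n) P i i0 * (P i0 i0)^*); last first.
      by rewrite sumr_const card_ord.
    by apply: eq_bigr => j _; rewrite !mxE (Pcst i j Di) (Pcst i0 j Di0).
  case: eqP => // _ /eqP; rewrite mulrn_eq0 mulf_eq0 conjC_eq0.
  by rewrite (negPf (Pi_neq0 _ Di)) (negPf (Pi_neq0 _ Di0)) (gtn_eqF n0).
have -> : y%:M - s *: W = invmx P *m diag_mx (\row_i (y - s * D 0 i)) *m P.
  have -> : diag_mx (\row_i (y - s * D 0 i)) = y%:M - s *: diag_mx D.
    by apply/matrixP => i j; rewrite !mxE; case: eqP => _;
      rewrite ?mulr1n ?mulr0n ?mulr0 ?subr0.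
  rewrite mulmxBr mulmxBl mul_mx_scalar -scalemxAr -!scalemxAl -WE.
  by rewrite mulVmx // scalemx1.
rewrite !det_mulmx mulrAC -det_mulmx mulVmx // det1 mul1r det_diag.
by apply: eq_bigr => i _; rewrite mxE.
Qed.

End CogramSpectrum.

(** * Explicit Kemeny constants of the two chains *)

(** [F] holds the extra factors left by the determinant identities. They need no cancelling, as
    their logarithmic derivative is subtracted. *)
Lemma kemeny_quotient n (P : 'M[algC]_n) (F G : {poly algC}) :
  F * char_poly P = ('X - 1%:P) * G -> F.[1] != 0 -> G.[1] != 0 ->
  kemeny P = logderiv1 G - logderiv1 F.
Proof.
move=> FG F0 G0.
have /factor_theorem[q def_q] : root (char_poly P) 1.
  have : root (F * char_poly P) 1 by rewrite FG rootM root_XsubC eqxx.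
  by rewrite rootM [root F 1]rootE (negPf F0).
have Fq : F * q = G.
  apply: (mulfI (negbT (polyXsubC_eq0 (1 : algC)))).
  by rewrite -FG def_q mulrCA [q * _]mulrC.
have q0 : q.[1] != 0 by apply: contraNneq G0 => q0; rewrite -Fq hornerM q0 mulr0.
rewrite (kemenyE _ q0) 1?mulrC // -Fq logderiv1M //.
by rewrite addrAC subrr add0r.
Qed.

Lemma logderiv1_X (R : fieldType) : logderiv1 ('X : {poly R}) = 1.
Proof. by rewrite /logderiv1 derivX !hornerE invr1. Qed.

Lemma logderiv1_Xadd1 (R : fieldType) : logderiv1 ('X + 1%:P : {poly R}) = 2^-1.
Proof. by rewrite /logderiv1 derivD derivX derivC !hornerE. Qed.

Lemma logderiv1_X2addC (R : fieldType) (r : R) :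
  logderiv1 ('X^2 + r%:P) = 2 / (1 + r).
Proof. by rewrite /logderiv1 derivD derivXn derivC !hornerE expr1n. Qed.

Section KemenyFormulas.

Variables (T : finType) (e : rel T) (A : {set T}) (c d : nat).

Local Notation m := #|A|.
Local Notation n := #|~: A|.
Local Notation W := (cogram e A).

Hypothesis e_sym : symmetric e.
Hypothesis e_bip : forall x y, e x y -> (x \in A) != (y \in A).
Hypothesis degA : forall x, x \in A -> deg e x = c.
Hypothesis degB : forall x, x \notin A -> deg e x = d.
Hypotheses (c_gt1 : (1 < c)%N) (d_gt1 : (1 < d)%N).

Variables (l : 'I_n -> algC) (i0 : 'I_n).
Hypothesis l_i0 : l i0 = c%:R * d%:R.
Hypothesis l_neq : forall i, i != i0 -> l i != c%:R * d%:R.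
Hypothesis det_cogram : forall y s, \det (y%:M - s *: W) = \prod_i (y - s * l i).

(** The S of the overview; it is Kemeny's constant of the two-step random walk on [~: A]. *)
Definition relax_sum : algC := \sum_(i | i != i0) (1 - l i / (c%:R * d%:R))^-1.

Let c0 : (c%:R : algC) != 0.
Proof. by rewrite pnatr_eq0 -lt0n ltnW. Qed.

Let d0 : (d%:R : algC) != 0.
Proof. by rewrite pnatr_eq0 -lt0n ltnW. Qed.

Let gap_neq0 i : i != i0 -> 1 - l i / (c%:R * d%:R) != 0.
Proof.
move=> /l_neq; apply: contraNneq => /eqP; rewrite subr_eq0 eq_sym => /eqP li.
by rewrite -(divfK (mulf_neq0 c0 d0) (l i)) li mul1r.
Qed.

Lemma K_eE : K_e e = 2 * (m * c)%:R - 2 * n%:R + 2^-1 + 2 * relax_sum.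
Proof.
pose F : {poly algC} := 'X^(m + n + n).
pose Q := \prod_(i | i != i0) ('X^2 + (- (l i / (c%:R * d%:R)))%:P).
(* The factor at [i0] is X^2 - 1; ['X + 1%:P] is what remains after removing X - 1. *)
pose G : {poly algC} := 'X^((m * c).*2 + m) * ('X + 1%:P) * Q.
have Qi i : i != i0 -> ('X^2 + (- (l i / (c%:R * d%:R)))%:P).[1] != 0.
  by rewrite !hornerE expr1n; exact: gap_neq0.
have Q0 : Q.[1] != 0 by rewrite horner_prod; apply/prodf_neq0.
have X10 : ('X + 1%:P : {poly algC}).[1] != 0 by rewrite !hornerE -mulr2n pnatr_eq0.
have X0 : ('X : {poly algC}).[1] != 0 by rewrite hornerX oner_eq0.
have Xn0 k : ('X^k : {poly algC}).[1] != 0 by rewrite hornerXn expr1n oner_eq0.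
have FG : F * char_poly (P_edge e) = ('X - 1%:P) * G.
  apply: poly_ext_horner => x.
  rewrite hornerM hornerXn (char_poly_edge e_sym e_bip degA degB) det_cogram.
  rewrite (card_arcs e_sym e_bip degA degB) (bigD1 i0) //= l_i0 /G /Q.
  rewrite mulVf ?mulf_neq0 // !hornerM hornerXn horner_prod.
  rewrite !(hornerD, hornerN, hornerX, hornerC).
  have -> : \prod_(i | i != i0) (x ^+ 2 - (c%:R * d%:R)^-1 * l i) =
      \prod_(i | i != i0) ('X^2 + (- (l i / (c%:R * d%:R)))%:P).[x].
    by apply: eq_bigr => i _; rewrite !hornerE [l i / _]mulrC.
  by ring.
rewrite /K_e (kemeny_quotient FG) ?Xn0 //; last first.
  by rewrite /G !hornerM !mulf_neq0 ?Xn0.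
rewrite /F /G !logderiv1M ?logderiv1X ?logderiv1_X ?hornerM ?mulf_neq0 //.
rewrite logderiv1_Xadd1 logderiv1_prod //.
under eq_bigr do rewrite logderiv1_X2addC.
rewrite -mulr_sumr -/relax_sum -muln2 !natrD !natrM.
by ring.
Qed.

Local Notation wA := ((c%:R - 1)^-1 : algC).
Local Notation wB := ((d%:R - 1)^-1 : algC).

(** At 1 the value is proportional to cd - u and the derivative to 2((cd - u) + (cd - c - d)), so
    the quotient is affine in the term that [relax_sum] adds up. *)
Lemma logderiv1_nb_factor (u : algC) :
  c%:R - 1 != 0 :> algC -> d%:R - 1 != 0 :> algC -> 1 - u / (c%:R * d%:R) != 0 ->
  let f := ('X^2 + wB%:P) * ('X^2 + wA%:P) - (wA * wB * u) *: 'X^2 in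
  f.[1] != 0 /\
  logderiv1 f = 2 + 2 * (1 - (c%:R + d%:R) / (c%:R * d%:R)) / (1 - u / (c%:R * d%:R)).
Proof.
move=> c1 d1 u1 f.
have cd_u : c%:R * d%:R - u != 0.
  apply: contraNneq u1 => /eqP; rewrite subr_eq0 => /eqP <-.
  by rewrite divff ?subrr // mulf_neq0.
have f1 : f.[1] = (c%:R * d%:R - u) / ((c%:R - 1) * (d%:R - 1)).
  by rewrite /f !(hornerD, hornerN, hornerM, hornerZ, hornerMn, hornerX, hornerC);
    field; rewrite c1 d1.
have f0 : f.[1] != 0 by rewrite f1 mulf_neq0 ?invr_neq0 ?mulf_neq0.
split=> //; rewrite /logderiv1 f1.
have -> : f^`().[1] =
    2 * ((c%:R * d%:R - u) + (c%:R * d%:R - c%:R - d%:R)) / ((c%:R - 1) * (d%:R - 1)).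
  rewrite /f derivB derivM !derivD !derivC derivZ !derivXn.
  rewrite !(hornerD, hornerN, hornerM, hornerZ, hornerMn, hornerX, hornerC).
  by field; rewrite c1 d1.
by field; rewrite c1 d1 c0 d0 cd_u.
Qed.

Lemma K_nbE : 1 - wA * wB != 0 -> 1 + wB != 0 ->
  K_nb e = ((m * c)%:R - m%:R - n%:R + 1) * (2 / (1 - wA * wB))
    + (m%:R - n%:R) * (2 / (1 + wB)) + 2^-1 + 2 * (n%:R - 1)
    + 2 * (1 - (c%:R + d%:R) / (c%:R * d%:R)) * relax_sum.
Proof.
move=> z1 a1.
have c1 : c%:R - 1 != 0 :> algC by rewrite subr_eq0 pnatr_eq1 gtn_eqF.
have d1 : d%:R - 1 != 0 :> algC by rewrite subr_eq0 pnatr_eq1 gtn_eqF.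
pose z : {poly algC} := 'X^2 + (- (wA * wB))%:P.
pose a : {poly algC} := 'X^2 + wB%:P.
pose f i := a * ('X^2 + wA%:P) - (wA * wB * l i) *: 'X^2.
pose F := z ^+ (m + n + m * c) * a ^+ n.
(* The factor at [i0] equals (X^2 - 1) z, which leaves ['X + 1%:P] and one more [z]. *)
pose G := z ^+ (m * c).*2 * a ^+ m * ('X + 1%:P) * z * \prod_(i | i != i0) f i.
have fP i : i != i0 -> _ := fun h => logderiv1_nb_factor c1 d1 (gap_neq0 h).
have z0 : z.[1] != 0 by rewrite /z !hornerE expr1n.
have a0 : a.[1] != 0 by rewrite /a !hornerE expr1n.
have zk k : (z ^+ k).[1] != 0 by rewrite horner_exp expf_neq0.
have ak k : (a ^+ k).[1] != 0 by rewrite horner_exp expf_neq0.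
have f0 i : i != i0 -> (f i).[1] != 0 by case/fP.
have Q0 : (\prod_(i | i != i0) f i).[1] != 0.
  by rewrite horner_prod; apply/prodf_neq0.
have X10 : ('X + 1%:P : {poly algC}).[1] != 0 by rewrite !hornerE -mulr2n pnatr_eq0.
have FG : F * char_poly (P_nb e) = ('X - 1%:P) * G.
  apply: poly_ext_horner => x.
  have zx : z.[x] = x ^+ 2 - wA * wB by rewrite /z !hornerE.
  have ax : a.[x] = x ^+ 2 + wB by rewrite /a !hornerE.
  rewrite hornerM /F hornerM !horner_exp zx ax.
  rewrite (char_poly_nb e_sym e_bip c_gt1 d_gt1 degA degB
    (card_arcs e_sym e_bip degA degB)).
  rewrite det_cogram (bigD1 i0) //= l_i0 /G !hornerM !horner_exp zx ax horner_prod.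
  have -> : \prod_(i | i != i0)
      ((x ^+ 2 + wB) * (x ^+ 2 + wA) - x ^+ 2 * wA * wB * l i) =
      \prod_(i | i != i0) (f i).[x].
    apply: eq_bigr => i _; rewrite /f /a.
    by rewrite !(hornerD, hornerN, hornerM, hornerZ, hornerMn, hornerX, hornerC); ring.
  have -> : (x ^+ 2 + wB) * (x ^+ 2 + wA) - x ^+ 2 * wA * wB * (c%:R * d%:R) =
      (x ^+ 2 - 1) * (x ^+ 2 - wA * wB).
    by field; rewrite c1 d1.
  by rewrite !(hornerD, hornerN, hornerX, hornerC); ring.
rewrite /K_nb (kemeny_quotient FG); last 2 first.
- by rewrite /F hornerM mulf_neq0.
- by rewrite /G !hornerM !mulf_neq0.
rewrite /F /G !logderiv1M ?logderiv1X ?hornerM ?mulf_neq0 //.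
rewrite logderiv1_Xadd1 logderiv1_prod //.
have -> : \sum_(i | i != i0) logderiv1 (f i) = 2 * (n%:R - 1) +
    2 * (1 - (c%:R + d%:R) / (c%:R * d%:R)) * relax_sum.
  rewrite (eq_bigr _ (fun i h => (fP i h).2)) big_split /= -mulr_sumr; congr (_ + _).
  rewrite sumr_const -[LHS]mulr_natr; congr (_ * _).
  have := cardC1 i0; rewrite card_ord => cardn.
  rewrite (eq_card (_ : _ =i predC1 i0)) // cardn.
  by rewrite -subn1 natrB // (leq_ltn_trans _ (ltn_ord i0)).
by rewrite !logderiv1_X2addC -muln2; ring.
Qed.

End KemenyFormulas.

(** * Sizes of the parts and the integer inequality *)

Section BiregularParts.

Variables (T : finType) (e : rel T) (A : {set T}) (c d : nat).
Hypothesis e_sym : symmetric e.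
Hypothesis e_bip : forall x y, e x y -> (x \in A) != (y \in A).
Hypothesis degA : forall x, x \in A -> deg e x = c.
Hypothesis degB : forall x, x \notin A -> deg e x = d.
Hypotheses (c_gt0 : (0 < c)%N) (d_gt0 : (0 < d)%N).

Lemma nbrs_subC x : x \in A -> [set y | e x y] \subset ~: A.
Proof.
by move=> xA; apply/subsetP => y; rewrite !inE => /e_bip; rewrite xA.
Qed.

Lemma parts_gt0 : (0 < #|T|)%N -> (0 < #|A|)%N /\ (0 < #|~: A|)%N.
Proof.
move=> /card_gt0P[x _].
have [y exy] : exists y, e x y.
  have : (0 < deg e x)%N by case: (boolP (x \in A)) => [/degA->|/degB->].
  by case/card_gt0P => y; rewrite inE; exists y.
have := e_bip exy; case: (boolP (x \in A)) => xA; case: (boolP (y \in A)) => yA // _.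
  by split; apply/card_gt0P; [exists x | exists y; rewrite inE].
by split; apply/card_gt0P; [exists y | exists x; rewrite inE].
Qed.

Lemma degree_le_part : (0 < #|A|)%N -> (c <= #|~: A|)%N.
Proof.
by case/card_gt0P => x xA; rewrite -(degA xA); apply/subset_leq_card/nbrs_subC.
Qed.

(** By cardinality, the neighbourhood of each vertex of [A] fills [~: A]. *)
Lemma complete_of_card : c = #|~: A| -> forall x y, e x y = ((x \in A) != (y \in A)).
Proof.
move=> cn.
have eA x y : x \in A -> y \notin A -> e x y.
  move=> xA yA; have /eqP E : [set y | e x y] == ~: A.
    by rewrite eqEcard nbrs_subC //= -cn -(degA xA).
  by have := in_setC y A; rewrite -E inE yA => ->.
move=> x y; apply/idP/idP; first exact: e_bip.
case: (boolP (x \in A)) => xA; case: (boolP (y \in A)) => yA // _; first exact: eA.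
by rewrite e_sym eA.
Qed.

End BiregularParts.

(** Since n >= c gives h >= w, the case w >= 4 is uniform. The few remaining degree pairs are those
    of the excluded graphs, so there n > c. The additive equations say that no subtraction
    truncates. *)
Lemma biregular_arith (c d m n : nat) :
  (2 <= c)%N -> (2 <= d)%N -> (c, d) <> (2%N, 2%N) -> (m * c = n * d)%N ->
  (c <= n)%N ->
  (n = c -> (c, d) \notin
    [:: (2, 3); (3, 2); (2, 4); (4, 2); (2, 5); (5, 2); (3, 3)]%N) ->
  exists w h, [/\ c * d = w + c + d, n * d = h + c + d, c * d < w * h & 0 < w]%N.
Proof.
move=> c2 d2 ncd mcnd cn excl.
have cd22 : (c != 2)%N || (d != 2)%N.
  by apply/negP => /negP; rewrite negb_or !negbK => /andP[/eqP cc /eqP dd];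
    apply: ncd; rewrite cc dd.
exists (c * d - c - d)%N, (n * d - c - d)%N.
have w0 : (c + d < c * d)%N.
  case: c c2 cd22 {mcnd cn excl ncd} => [//|[//|a]] _ ab.
  case: d d2 ab => [//|[//|b]] _ ab.
  have {ab} ab : (0 < a + b)%N by lia.
  by nia.
have nd : (c * d <= n * d)%N by rewrite leq_mul2r cn orbT.
set w := (c * d - c - d)%N; set h := (n * d - c - d)%N.
have wE : (c * d = w + c + d)%N by rewrite /w; lia.
have hE : (n * d = h + c + d)%N by rewrite /h; lia.
have le_wh : (w <= h)%N by lia.
have w_gt0 : (0 < w)%N by lia.
have excl' : n = c -> ~~ [|| (c == 2) && (d == 3), (c == 3) && (d == 2),
  (c == 2) && (d == 4), (c == 4) && (d == 2), (c == 2) && (d == 5),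
  (c == 5) && (d == 2) | (c == 3) && (d == 3)]%N.
  by move/excl; rewrite !inE !xpair_eqE.
clear excl ncd.
split=> //; clearbody w h.
have bound k : (k <= h)%N -> (c * d < w * k)%N -> (c * d < w * h)%N.
  by move=> kh /leq_trans; apply; rewrite leq_mul2l kh orbT.
have [c3|c3] := leqP 3 c; have [d3|d3] := leqP 3 d; last by lia.
- have [cd7|cd7] := leqP 7 (c + d).
    have : (3 * c <= c * d)%N by rewrite mulnC leq_mul2l d3 orbT.
    have : (3 * d <= c * d)%N by rewrite leq_mul2r c3 orbT.
    by move=> ? ?; apply: (bound 4%N); lia.
  have [c33 d33] : c = 3%N /\ d = 3%N by lia.
  subst c d; have w3 : w = 3%N by lia.
  by subst w; lia.
- have dd : d = 2%N by lia.
  subst d; have [c6|c6] := leqP 6 c; first by apply: (bound 4%N); lia.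
  (* For c = 3 and c = 4, n > c is not enough: [mcnd] makes n a multiple of 3, respectively even,
     hence n >= 6. *)
  have [cc|[cc|cc]] : c = 3%N \/ c = 4%N \/ c = 5%N by lia.
  + by subst c; have w1 : w = 1%N by [lia]; subst w; lia.
  + by subst c; have w1 : w = 2%N by [lia]; subst w; lia.
  + by subst c; have w1 : w = 3%N by [lia]; subst w; lia.
- have cc : c = 2%N by lia.
  subst c; have [d6|d6] := leqP 6 d; first by apply: (bound 4%N); lia.
  have [dd|[dd|dd]] : d = 3%N \/ d = 4%N \/ d = 5%N by lia.
  + by subst d; have w1 : w = 1%N by [lia]; subst w; lia.
  + by subst d; have w1 : w = 2%N by [lia]; subst w; lia.
  + by subst d; have w1 : w = 3%N by [lia]; subst w; lia.
Qed.

(** * Assembly of the two bounds *)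

Theorem theorem4p5 (T : finType) (e : rel T) (c d : nat) :
  (0 < #|T|)%N ->
  simple_graph e -> connected_graph e -> biregular e c d ->
  (2 <= c)%N -> (2 <= d)%N -> (c, d) <> (2%N, 2%N) ->
  ~ is_complete_bipartite e 2 3 -> ~ is_complete_bipartite e 2 4 ->
  ~ is_complete_bipartite e 2 5 -> ~ is_complete_bipartite e 3 3 ->
  1 - (c%:R + d%:R) / (c%:R * d%:R) <= K_nb e / K_e e :> algC /\
  K_nb e / K_e e < 1.
Proof.
move=> T0 [e_sym _] e_conn [A [e_bip degA degB]] c2 d2 cd22 K23 K24 K25 K33.
have [m0 n0] := parts_gt0 e_bip degA degB (ltnW c2) (ltnW d2) T0.
have cn := degree_le_part e_bip degA m0.
have mcnd := card_parts e_sym e_bip degA degB.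
have excl : #|~: A| = c -> (c, d) \notin
    [:: (2, 3); (3, 2); (2, 4); (4, 2); (2, 5); (5, 2); (3, 3)]%N.
  move=> nc; have eE := complete_of_card e_sym e_bip degA (esym nc).
  have md : #|A| = d.
    by apply/eqP; rewrite -(eqn_pmul2r (ltnW c2)) mcnd nc mulnC.
  (* Both orders of the parts are recorded, as the excluded degree pairs occur in either order. *)
  have Kdc : is_complete_bipartite e d c by exists A.
  have Kcd : is_complete_bipartite e c d.
    exists (~: A); split=> [//||x y]; first by rewrite setCK.
    by rewrite eE !inE; case: (x \in A); case: (y \in A).
  apply/negP; rewrite !inE.
  by case/or4P => [|||/or4P[]] /eqP[cc dd]; move: Kdc Kcd; rewrite cc dd.
have [w [h [cdE ndE cdwh w0]]] := biregular_arith c2 d2 cd22 mcnd cn excl.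
have [l [i0 [li0 l_bound detW]]] :=
  cogram_spectrum e_sym e_conn e_bip degA degB n0.
have l_neq i : i != i0 -> l i != c%:R * d%:R.
  by move=> /l_bound/andP[_ ?]; rewrite lt_eqF.
have KeE := K_eE e_sym e_bip degA degB c2 d2 li0 l_neq detW.
have KnbE := K_nbE e_sym e_bip degA degB c2 d2 li0 l_neq detW.
set S := relax_sum c d l i0 in KeE KnbE.
have cd_gt0 : 0 < c%:R * d%:R :> algC by rewrite mulr_gt0 // ltr0n ltnW.
(* The other eigenvalues lie in [0, cd[, so each of the n - 1 terms is at least 1. *)
have S_ge : #|~: A|%:R - 1 <= S.
  have -> : #|~: A|%:R - 1 = \sum_(i | i != i0) 1 :> algC.
    have : \sum_(i < #|~: A|) 1 = #|~: A|%:R :> algC.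
      by rewrite sumr_const card_ord.
    by move <-; rewrite (bigD1 i0) //= addrC addrK.
  apply: ler_sum => i /l_bound/andP[l_ge l_lt].
  rewrite -[leLHS]invr1 lef_pV2 ?posrE //; last first.
    by rewrite subr_gt0 ltr_pdivrMr // mul1r.
  by rewrite gerBl divr_ge0 // ltW.
move: KeE KnbE S_ge; set m := #|A|; set n := #|~: A|.
(* With the excess [r] over this lower bound as variable, the signs below can be read off
   termwise. *)
have [r ->] : exists r, S = n%:R - 1 + r by exists (S - (n%:R - 1)); ring.
rewrite lerDl => KeE KnbE r_ge0.
have c0 : c%:R != 0 :> algC by rewrite pnatr_eq0 -lt0n ltnW.
have d0 : d%:R != 0 :> algC by rewrite pnatr_eq0 -lt0n ltnW.
have c1 : c%:R - 1 != 0 :> algC by rewrite subr_eq0 pnatr_eq1 gtn_eqF.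
have d1 : d%:R - 1 != 0 :> algC by rewrite subr_eq0 pnatr_eq1 gtn_eqF.
have wE : w%:R = c%:R * d%:R - c%:R - d%:R :> algC.
  by rewrite -natrM cdE !natrD; ring.
have wn0 : c%:R * d%:R - c%:R - d%:R != 0 :> algC.
  by rewrite -wE pnatr_eq0 -lt0n.
have hE : h%:R = n%:R * d%:R - c%:R - d%:R :> algC.
  by rewrite -natrM ndE !natrD; ring.
have mE : m%:R = n%:R * d%:R / c%:R :> algC.
  by rewrite -natrM -mcnd natrM mulfK.
have z1 : 1 - (c%:R - 1)^-1 * (d%:R - 1)^-1 != 0 :> algC.
  have -> : 1 - (c%:R - 1)^-1 * (d%:R - 1)^-1 =
    (c%:R * d%:R - c%:R - d%:R) / ((c%:R - 1) * (d%:R - 1)) :> algC.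
    by field; rewrite c1 d1.
  by rewrite mulf_neq0 ?invr_neq0 ?mulf_neq0.
have a1 : 1 + (d%:R - 1)^-1 != 0 :> algC.
  have -> : 1 + (d%:R - 1)^-1 = d%:R / (d%:R - 1) :> algC by field; rewrite d1.
  by rewrite mulf_neq0 ?invr_neq0.
have {}KnbE := KnbE z1 a1.
have Ke_gt0 : 0 < K_e e.
  have -> : K_e e = 2 * n%:R * d.-1%:R + 2 * n.-1%:R + 2 * r + 2^-1.
    rewrite KeE mcnd natrM -[d.-1]subn1 natrB ?(ltnW d2) //.
    by rewrite -[n.-1]subn1 natrB //; ring.
  by rewrite ltr_wpDl ?invr_gt0 ?ltr0n // !addr_ge0 ?mulr_ge0 ?ler0n.
pose alpha : algC := 1 - (c%:R + d%:R) / (c%:R * d%:R).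
rewrite -/alpha ler_pdivlMr // ltr_pdivrMr // mul1r -subr_ge0 -[_ < _]subr_gt0.
(* The eigenvalue sum cancels, its coefficient being 2 [alpha] in [K_nb e] and 2 in [K_e e]. *)
have -> : K_nb e - alpha * K_e e =
    2 / w%:R + (c%:R + d%:R) / (c%:R * d%:R) / 2 + 2 * m%:R + 2 * n%:R / d%:R
    + 2 * n%:R * (w%:R / (c%:R * d%:R)).
  rewrite KnbE KeE wE /alpha natrM mE.
  by field; rewrite ?c0 ?d0 ?c1 ?d1 ?wn0.
(* The excess [r] has a nonnegative coefficient, so positivity rests on the integer inequality
   [cdwh]. *)
have -> : K_e e - K_nb e = 2 / (c%:R * d%:R * w%:R) *
    ((c%:R + d%:R) * w%:R * r + (w%:R * h%:R - c%:R * d%:R)).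
  rewrite KnbE KeE hE wE /alpha natrM mE.
  by field; rewrite ?c0 ?d0 ?c1 ?d1 ?wn0.
split.
  by do ![exact: ler0n | rewrite invr_ge0 | apply: addr_ge0 | apply: mulr_ge0].
apply: mulr_gt0; first by rewrite divr_gt0 // mulr_gt0 // ltr0n.
apply: ltr_wpDl; first by rewrite !mulr_ge0 ?addr_ge0 ?ler0n.
by rewrite subr_gt0 -!natrM ltr_nat.
Qed.
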